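(* Let $S\in\tfrac12\mathbb{N}$, $\theta=2S+1$, and $\beta>0$. With $Z_n(\beta)=\mathrm{tr}\big(e^{-(\beta/n)H_n}\big)$ and $\phi_\beta$, $\Delta$ as in the context, \[ \lim_{n\to\infty}\frac1n\log Z_n(\beta)=\max_{x\in\Delta}\phi_\beta(x). \]
   Context: Let $S^1,S^2,S^3$ be the spin-$S$ operators on $\mathcal H=\mathbb{C}^{2S+1}$, and let $\{|a\rangle: a\in\{-S,-S+1,\dots,S\}\}$ be the orthonormal basis of eigenvectors of $S^3$ ($S^3|a\rangle=a|a\rangle$). Let $V=\{1,\dots,n\}$ and $E$ the set of all unordered pairs $xy$ of distinct vertices (the complete graph $K_n$). Let $\mathcal H_V=\bigotimes_{x\in V}\mathcal H_x$, each $\mathcal H_x$ a copy of $\mathcal H$, with basis $|\mathbf a\rangle=\otimes_{x\in V}|a_x\rangle$, $\mathbf a\in\{-S,\dots,S\}^V$. For $x\neq y$ the transposition operator $T_{xy}$ is defined by $T_{xy}\otimes_{z}|a_z\rangle=\otimes_z|a_{\tau(z)}\rangle$ where $\tau$ is the transposition of $x$ and $y$. Let $H_n=-\sum_{xy\in E}(T_{xy}-1)$. Let $\Delta=\{x\in[0,1]^\theta: x_1\ge\dots\ge x_\theta,\ \sum_{j=1}^\theta x_j=1\}$ and $\phi_\beta(x)=\frac\beta2\big(\sum_{j=1}^\theta x_j^2-1\big)-\sum_{j=1}^\theta x_j\log x_j$ (with $0\log 0=0$). *)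

(* Defs.v *)
From HB Require Import structures.
From mathcomp Require Import all_boot all_order all_algebra all_fingroup.
From mathcomp Require Import all_classical all_reals all_analysis.
Set Implicit Arguments. Unset Strict Implicit. Unset Printing Implicit Defensive.
Import Order.TTheory GRing.Theory Num.Theory.
Local Open Scope ring_scope.

Section Defs.
Variable R : realType.

Definition mpow (N : nat) (A : 'M[R]_N) (k : nat) : 'M[R]_N :=
  iter k (mulmx A) 1%:M.

Definition mexp (N : nat) (A : 'M[R]_N) : 'M[R]_N :=
  \matrix_(i, j) (limn (fun m : nat => \sum_(0 <= k < m) ((mpow A k) i j / (k`!)%:R))).

(* Spin-S with theta = 2S+1 = twoS.+1 local states; the label a : 'I_theta
   stands for the S^3-eigenvalue a - S.  Basis of H_V: configurations
   a : V -> {local states}, V = 'I_n = {1..n}. *)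
Definition config (n theta : nat) := {ffun 'I_n -> 'I_theta}.

Definition dimH (n theta : nat) := #|{: config n theta}|.

(* Transposition operator T_xy : |a> |-> |a o tau>, tau = (x y).
   Matrix entry <b| T_xy |a> = [b == a o tau]. *)
Definition Tmat (n theta : nat) (x y : 'I_n) : 'M[R]_(dimH n theta) :=
  \matrix_(i, j)
    (((enum_val i : config n theta) ==
      [ffun z => (enum_val j : config n theta) (tperm x y z)]) %:R).

Definition Hn (n theta : nat) : 'M[R]_(dimH n theta) :=
  - \sum_(x < n) \sum_(y < n | (x < y)%N) (Tmat theta x y - 1%:M).

Definition Zn (theta : nat) (beta : R) (n : nat) : R :=
  \tr (mexp (- (beta / n%:R) *: Hn n theta)).

Definition Delta (theta : nat) : set ('I_theta -> R) :=
  [set x | (forall j, 0 <= x j <= 1) /\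
           (forall i j : 'I_theta, (i <= j)%N -> x j <= x i) /\
           \sum_(j < theta) x j = 1].

Definition xlogx (t : R) : R := if t == 0 then 0 else t * ln t.

Definition phi (theta : nat) (beta : R) (x : 'I_theta -> R) : R :=
  beta / 2 * (\sum_(j < theta) x j ^+ 2 - 1) - \sum_(j < theta) xlogx (x j).

End Defs.

Arguments phi {R} theta beta x.
Arguments Delta {R} theta.
Arguments Zn {R} theta beta n.

(* Main.v *)
Require Import Defs.
From HB Require Import structures.
From mathcomp Require Import all_boot all_order all_algebra all_fingroup.
From mathcomp Require Import all_classical all_reals all_analysis.
From mathcomp Require Import ring lra.
Set Implicit Arguments. Unset Strict Implicit. Unset Printing Implicit Defensive.
Import Order.TTheory GRing.Theory Num.Theory.
Local Open Scope ring_scope.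
Import numFieldNormedType.Exports.
Local Open Scope classical_set_scope.

(** Let [E_ij] be the sum over the sites of the elementary matrices [e_ij]. The
    Casimir element [C = \sum_(i, j) E_ij E_ji] of this representation of [gl_theta]
    equals [n theta + \sum_(x <> y) T_xy], so the Hamiltonian is affine in [C].

    Upper bound. A nilpotent [N] with [N ^ (n + 1) = 0] leaving a space [W]
    invariant satisfies [dim W <= (n + 1) dim (W \cap ker N)]. Applied to the
    raising operators [E_ij], [i < j], by decreasing height [j - i], this bounds the
    dimension of each eigenspace of [C] by a polynomial in [n] times the dimension
    of its highest weight vectors. On these [C] acts as a diagonal matrix with
    entries [\sum_i n_i^2 + O(n)], where [n_i] is the number of sites in state [i].
    Hence [Z_n] is at most a polynomial times the classical sum over configurations
    of [exp (n beta / 2 (\sum_i x_i^2 - 1))], [x = n_. / n], which the method of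
    types bounds by a polynomial times [exp (n max phi)].

    Lower bound. Peierls' inequality bounds [Z_n] from below by the sum of the
    exponentials of the diagonal entries, and the Gibbs variational inequality with
    the product measure of [x] gives [phi x <= ln Z_n / n] for all [n > 0]. *)

(** * Linear algebra *)

(** Multiplying [W *m N ^+ i] by [N] loses the dimension of its intersection with [kermx N], which
    by stability lies in [W :&: kermx N]; after [k] multiplications nothing is left. *)
Lemma mxrank_nilpotent_ker (F : fieldType) (d k : nat) (W N : 'M[F]_d) :
  (W *m N <= W)%MS -> N ^+ k = 0 ->
  (\rank W <= k * \rank (W :&: kermx N)%MS)%N.
Proof.
move=> WN Nk.
have WNX i : (W *m N ^+ i <= W)%MS.
  elim: i => [|i IH]; first by rewrite expr0 mulmx1.
  by rewrite exprSr mulmxA (submx_trans (submxMr N IH)).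
suff H i : (i <= k)%N ->
    (\rank (W *m N ^+ (k - i)) <= i * \rank (W :&: kermx N)%MS)%N.
  by have := H k (leqnn k); rewrite subnn expr0 mulmx1.
elim: i => [_|i IH lik]; first by rewrite subn0 Nk mulmx0 mxrank0.
rewrite -(mxrank_mul_ker _ N) mulSn addnC leq_add //.
  by apply/mxrankS/capmxS.
rewrite -mulmxA -[X in W *m X]/(N ^+ (k - i.+1) * N) -exprSr.
by rewrite -subSn // subSS IH // ltnW.
Qed.

Section RankDiag.
Variables (F : fieldType) (d : nat) (P : pred 'I_d).

Definition support_mx : 'M[F]_d := diag_mx (\row_j (P j)%:R).

Lemma sub_support_mx (m : nat) (A : 'M[F]_(m, d)) :
  (forall i j, ~~ P j -> A i j = 0) -> (A <= support_mx)%MS.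
Proof.
move=> A0; suff -> : A = A *m support_mx by exact: submxMl.
apply/matrixP=> i j; rewrite mul_mx_diag !mxE.
by case: (boolP (P j)) => [_|/A0->]; rewrite ?mulr1 ?mul0r.
Qed.

(** The matrix factors as [B^T *m B] through a space of dimension [#|P|], with [B *m B^T = 1%:M]. *)
Lemma rank_support_mx : \rank support_mx = #|P|.
Proof.
pose B : 'M[F]_(#|P|, d) := \matrix_(i, j) (enum_val i == j)%:R.
have BB : B *m B^T = 1%:M.
  apply/matrixP=> i j; rewrite !mxE (bigD1 (enum_val i)) //= !mxE eqxx mul1r.
  rewrite big1 ?addr0 => [|k kI]; first by rewrite (inj_eq enum_val_inj) eq_sym.
  by rewrite !mxE eq_sym (negPf kI) mul0r.
have SB : support_mx = B^T *m B.
  apply/matrixP=> i j; rewrite !mxE.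
  under eq_bigr do rewrite !mxE.
  rewrite -(big_enum_val (A := P) (fun k => (k == i)%:R * (k == j)%:R)) /=.
  case: (boolP (i \in P)) => Pi.
    rewrite (bigD1 i) //= eqxx mul1r big1 ?addr0.
      by rewrite unfold_in in Pi; case: eqP => [_|_]; rewrite ?mulr1n ?Pi.
    by move=> k /andP[_ /negPf->]; rewrite mul0r.
  rewrite big1 => [|k Pk]; first last.
    by case: eqP => [ki|]; rewrite ?mul0r // -ki Pk in Pi *.
  by rewrite unfold_in in Pi; rewrite (negPf Pi) mul0rn.
apply/eqP; rewrite eqn_leq; apply/andP; split.
  by rewrite SB (leq_trans (mxrankM_maxr _ _)) ?rank_leq_row.
have -> : #|P| = \rank (B *m support_mx *m B^T).
  by rewrite SB mulmxA BB mul1mx BB mxrank1.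
by rewrite (leq_trans (mxrankM_maxl _ _)) ?mxrankM_maxr.
Qed.
End RankDiag.

(** Row [i] of [P] is an eigenvector of [C] for [D ord0 i], and the rows with value [c] are
    independent because [P] is invertible. *)
Lemma card_diag_eigenvalue (F : fieldType) (d : nat) (P C : 'M[F]_d) (D : 'rV_d)
    (c : F) : P \in unitmx -> P *m C = diag_mx D *m P ->
  (#|[pred i | D ord0 i == c]| <= \rank (eigenspace C c))%N.
Proof.
move=> Pu PC; set S := [pred i | _].
rewrite -(rank_support_mx F S) -(mxrankMfree _ (_ : row_free P)) ?row_free_unit //.
apply/mxrankS/eigenspaceP; rewrite -mulmxA PC mulmxA scalemxAl; congr (_ *m P).
apply/matrixP=> i j; rewrite mul_mx_diag !mxE mulrC.
case: (i =P j) => [<-|_]; rewrite ?mulr0n ?mulr0 // !mulr1n.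
by case: (boolP (S i)) => [/eqP->|]; rewrite ?mulr0.
Qed.

(** The minimal polynomial divides a product of distinct linear factors. *)
Lemma split_simple_diagonalizable (F : fieldType) (d : nat) (C : 'M[F]_d) (rs : seq F) :
  uniq rs -> \prod_(c <- rs) (C - c%:M) = 0 ->
  exists (P : 'M[F]_d) (D : 'rV[F]_d), P \in unitmx /\ P *m C = diag_mx D *m P.
Proof.
case: d C => [|d] C urs C0.
  exists 1%:M, 0; rewrite unitmx1; split => //; by apply/matrixP=> -[].
have [P Pu +] : exists2 P, P \in unitmx & similar_diag P C.
  apply/diagonalizableP; exists rs => //; apply: mxminpoly_min.
  rewrite rmorph_prod -[RHS]C0; apply: eq_bigr => c _.
  by rewrite rmorphB /= horner_mx_X horner_mx_C.
by case/similar_diagPex=> D /(similarP Pu); exists P, D.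
Qed.

(** * Highest weight vectors and the Casimir element *)

Section GlRepresentation.
Variables (R : realFieldType) (t d m : nat) (E : 'I_t -> 'I_t -> 'M[R]_d).
Variable (w : 'I_t -> 'rV[R]_d).
Hypothesis E_commutator : forall i j k l,
  E i j * E k l = E k l * E i j + (j == k)%:R *: E i l - (l == i)%:R *: E k j.
Hypothesis E_nilpotent : forall i j, i != j -> E i j ^+ m.+1 = 0.
Hypothesis E_tr : forall i j, (E i j)^T = E j i.
Hypothesis E_diag : forall i, E i i = diag_mx (w i).

Definition casimir : 'M[R]_d := \sum_i \sum_j E i j * E j i.

Lemma casimir_tr : casimir^T = casimir.
Proof.
rewrite /casimir raddf_sum; apply: eq_bigr => i _; rewrite raddf_sum.
by apply: eq_bigr => j _; rewrite /= -mulmxE trmx_mul !E_tr.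
Qed.

Lemma sum_delta (V : lmodType R) (k : 'I_t) (f : 'I_t -> V) :
  \sum_i (i == k)%:R *: f i = f k.
Proof.
rewrite (bigD1 k) //= eqxx scale1r big1 ?addr0 // => i /negPf->.
by rewrite scale0r.
Qed.

Lemma casimir_comm k l : casimir * E k l = E k l * casimir.
Proof.
(* [E k l] moves left past [E j i], then past [E i j]. After summation each Kronecker delta
   collapses one index and the four corrections cancel in pairs. *)
have step i j : E i j * E j i * E k l = E k l * (E i j * E j i)
    + (i == k)%:R *: (E i j * E j l) - (j == l)%:R *: (E i j * E k i)
    + (j == k)%:R *: (E i l * E j i) - (i == l)%:R *: (E k j * E j i).
  rewrite -mulrA (E_commutator j i) (eq_sym l j) (eq_sym i k) -!mulmxE mulmxBr mulmxDr.
  rewrite -!scalemxAr (mulmxA (E i j) (E k l)) [E i j *m E k l]E_commutator.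
  rewrite mulmxBl mulmxDl -!scalemxAl -mulmxA (eq_sym l i) (eq_sym k i).
  by rewrite -!addrA; congr (_ + _); rewrite addrA addrC -!addrA; congr (_ + _).
rewrite /casimir mulr_suml mulr_sumr.
under eq_bigr do rewrite mulr_suml (eq_bigr _ (fun j _ => step _ j)).
under [RHS]eq_bigr do rewrite mulr_sumr.
under eq_bigr do rewrite !big_split /= !sumrN.
rewrite !big_split /= !sumrN -!addrA -[RHS]addr0; congr (_ + _).
have -> : \sum_i \sum_j (i == k)%:R *: (E i j * E j l) = \sum_j E k j * E j l.
  by rewrite exchange_big; apply: eq_bigr => j _; rewrite sum_delta.
have -> : \sum_i \sum_j (i == l)%:R *: (E k j * E j i) = \sum_j E k j * E j l.
  by rewrite exchange_big; apply: eq_bigr => j _; rewrite sum_delta.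
have -> : \sum_i \sum_j (j == l)%:R *: (E i j * E k i) = \sum_i E i l * E k i.
  by apply: eq_bigr => i _; rewrite sum_delta.
have -> : \sum_i \sum_j (j == k)%:R *: (E i l * E j i) = \sum_i E i l * E k i.
  by apply: eq_bigr => i _; rewrite sum_delta.
by rewrite addKr subrr.
Qed.

(** The value of the Casimir element on a highest weight vector. The linear term has the opposite of
    its usual sign because matrices act on row vectors from the right. *)
Definition weight_casimir (a : 'I_d) : R :=
  \sum_i w i ord0 a ^+ 2 - \sum_(i < t) \sum_(j < t | (i < j)%N) (w i ord0 a - w j ord0 a).

(** For [i < j] the factor [E i j] kills [V]; for [j < i] the commutator brings [E j i] to the front
    and leaves [E i i - E j j]. *)
Lemma highest_weight_casimir p (V : 'M[R]_(p, d)) :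
  (forall i j : 'I_t, (i < j)%N -> V *m E i j = 0) ->
  V *m casimir = V *m diag_mx (\row_a weight_casimir a).
Proof.
move=> V0.
have VE i j : V *m (E i j * E j i) =
    V *m ((i == j)%:R *: (E i i * E i i) + (j < i)%N%:R *: (E i i - E j j)).
  case: (ltngtP i j) => [ij|ji|/val_inj ->].
  - rewrite -mulmxE mulmxA V0 // mul0mx.
    by rewrite -(inj_eq val_inj) /= ltn_eqF // !scale0r addr0 mulmx0.
  - rewrite (E_commutator i j) !eqxx !scale1r -mulmxE mulmxBr mulmxDr mulmxA V0 //.
    by rewrite -(inj_eq val_inj) /= gtn_eqF // scale0r mul0mx !add0r mulmxBr.
  - by rewrite eqxx scale1r scale0r addr0.
rewrite /casimir mulmx_sumr.
under eq_bigr do rewrite mulmx_sumr (eq_bigr _ (fun j _ => VE _ j)) -mulmx_sumr.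
rewrite -mulmx_sumr; congr (_ *m _).
apply/matrixP=> a b; rewrite summxE !mxE.
under eq_bigr do rewrite summxE.
under eq_bigr => i _ do under eq_bigr => j _ do
  rewrite !E_diag -mulmxE mulmx_diag !mxE.
have [_|_] := eqVneq a b; last first.
  by rewrite mulr0n big1 // => i _; rewrite big1 // => j _;
    rewrite !mulr0n subr0 !mulr0 addr0.
rewrite mulr1n /weight_casimir.
under eq_bigr do rewrite big_split /=.
rewrite big_split /=; congr (_ + _).
  rewrite exchange_big; apply: eq_bigr => j _.
  rewrite (bigD1 j) //= big1 ?addr0 ?eqxx ?mul1r ?mulr1n //.
  by move=> i /negPf->; rewrite mul0r.
rewrite exchange_big -sumrN; apply: eq_bigr => j _.
rewrite -sumrN [RHS]big_mkcond; apply: eq_bigr => i _.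
by case: ifP; rewrite ?mul0r // mul1r !mulr1n opprB.
Qed.

Definition raising_stable (W : 'M[R]_d) :=
  forall i j : 'I_t, (i < j)%N -> (W *m E i j <= W)%MS.

Lemma kill_sub p q (V : 'M[R]_(p, d)) (W : 'M[R]_(q, d)) (A : 'M[R]_d) :
  (V <= W)%MS -> W *m A = 0 -> V *m A = 0.
Proof. by case/submxP=> X -> ; rewrite -mulmxA => ->; rewrite mulmx0. Qed.

(* Restricting to the kernel of a raising operator keeps stability as long as
   its brackets with the raising operators, which are longer roots, vanish. *)
Lemma kill_longest_roots (k : nat) (s : seq ('I_t * 'I_t)) (W : 'M[R]_d) :
  raising_stable W ->
  (forall i j : 'I_t, (i < j)%N -> (i + t < j + k)%N -> W *m E i j = 0) ->
  (forall p, p \in s -> (p.1 < p.2)%N && (p.1 + t <= p.2 + k)%N) ->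
  exists W', [/\ (W' <= W)%MS, raising_stable W',
    forall p, p \in s -> W' *m E p.1 p.2 = 0 &
    (\rank W <= m.+1 ^ size s * \rank W')%N].
Proof.
move=> stW W0; elim: s => [_|[i j] s IH sP].
  by exists W; split=> //; rewrite expn0 mul1n.
have [p ps|W1 [W1W stW1 W1s rW1]] := IH; first by apply: sP; rewrite inE ps orbT.
have /= /andP[ij ijk] := sP (i, j) (mem_head _ _).
exists (W1 :&: kermx (E i j))%MS; split.
- by rewrite (submx_trans _ W1W) // capmxSl.
- move=> a b ab; rewrite sub_capmx (submx_trans (submxMr _ (capmxSl _ _))) ?stW1 //=.
  apply/sub_kermxP; rewrite -mulmxA [E a b *m E i j]E_commutator mulmxBr mulmxDr -mulmxE.
  have -> : (W1 :&: kermx (E i j))%MS *m (E i j *m E a b) = 0.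
    by rewrite mulmxA (kill_sub (capmxSr _ _) (mulmx_ker _)) mul0mx.
  have sW : (W1 :&: kermx (E i j) <= W)%MS by rewrite (submx_trans (capmxSl _ _)).
  rewrite add0r -!scalemxAr.
  have -> : (b == i)%:R *: ((W1 :&: kermx (E i j))%MS *m E a j) = 0.
    case: eqP => [bi|_]; last by rewrite scale0r.
    rewrite scale1r (kill_sub sW) // W0 //; rewrite bi in ab; first exact: ltn_trans ij.
    by apply: leq_trans ijk; rewrite ltn_add2r.
  have -> : (j == a)%:R *: ((W1 :&: kermx (E i j))%MS *m E i b) = 0.
    case: eqP => [ja|_]; last by rewrite scale0r.
    rewrite scale1r (kill_sub sW) // W0 //; rewrite -ja in ab; first exact: ltn_trans ab.
    by apply: leq_ltn_trans ijk _; rewrite ltn_add2r.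
  by rewrite subr0.
- move=> p; rewrite inE => /orP[/eqP->|ps] /=.
    exact: kill_sub (capmxSr _ _) (mulmx_ker _).
  exact: kill_sub (capmxSl _ _) (W1s _ ps).
- apply: leq_trans rW1 _; rewrite /= expnSr -mulnA leq_mul2l.
  rewrite mxrank_nilpotent_ker ?orbT ?stW1 // E_nilpotent //.
  by rewrite -(inj_eq val_inj) /= ltn_eqF.
Qed.

(** There are [t] stages, one per height, each killing at most [t * t] roots; every root costs at
    most a factor [m.+1] in rank. *)
Lemma exists_highest_weight (W : 'M[R]_d) : raising_stable W ->
  exists W' : 'M[R]_d, [/\ (W' <= W)%MS,
    forall i j : 'I_t, (i < j)%N -> W' *m E i j = 0 &
    (\rank W <= m.+1 ^ (t * t * t) * \rank W')%N].
Proof.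
(* The condition [i + t < j + k] expresses [j - i > t - k] without truncated subtraction: no pair
   satisfies it at [k = 0], and at [k = t] it reads [i < j]. *)
move=> stW; suff H k : exists W' : 'M[R]_d, [/\ (W' <= W)%MS, raising_stable W',
    forall i j : 'I_t, (i < j)%N -> (i + t < j + k)%N -> W' *m E i j = 0 &
    (\rank W <= m.+1 ^ (k * (t * t)) * \rank W')%N].
  have [W' [W'W _ W'0 rW]] := H t; exists W'; split=> //.
    by move=> i j ij; rewrite W'0 // ltn_add2r.
  by rewrite -mulnA.
elim: k => [|k [W1 [W1W stW1 W10 rW1]]].
  exists W; split=> //; last by rewrite mul0n expn0 mul1n.
  move=> i j _; rewrite addn0 => /(leq_ltn_trans (leq_addl i t)).
  by rewrite ltnNge (ltnW (ltn_ord j)).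
pose s := [seq p : 'I_t * 'I_t <- enum {: 'I_t * 'I_t} | (p.1 < p.2)%N && (p.1 + t <= p.2 + k)%N].
have [p|W2 [W21 stW2 W20 rW2]] := kill_longest_roots (s := s) stW1 W10.
  by rewrite mem_filter => /andP[].
exists W2; split=> //; first exact: submx_trans W21 W1W.
  move=> i j ij ijk; apply: (W20 (i, j)).
  by rewrite addnS ltnS in ijk; rewrite mem_filter mem_enum /= ij ijk.
apply: leq_trans rW1 _; rewrite mulSn addnC expnD -mulnA leq_mul2l.
apply/orP; right; apply: leq_trans rW2 _; rewrite leq_mul2r leq_pexp2l ?orbT //.
by rewrite size_filter (leq_trans (count_size _ _)) // -cardE card_prod card_ord.
Qed.

(** The eigenspace is stable because [casimir] commutes with every [E i j]. On its highest weight
    vectors [casimir] acts both as [c] and as a diagonal matrix, so only coordinates [a] with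
    [weight_casimir a = c] survive. *)
Lemma rank_eigenspace_casimir (c : R) :
  (\rank (eigenspace casimir c) <=
     m.+1 ^ (t * t * t) * #|[pred a | weight_casimir a == c]|)%N.
Proof.
have [|W [Wc W0]] := @exists_highest_weight (eigenspace casimir c).
  move=> i j _; apply/eigenspaceP.
  rewrite -mulmxA mulmxE -casimir_comm -mulmxE mulmxA.
  by rewrite (eigenspaceP (submx_refl _)) scalemxAl.
move/leq_trans; apply; rewrite leq_mul2l; apply/orP; right.
rewrite -(rank_support_mx R); apply/mxrankS/sub_support_mx => i a /= fc.
have /eigenspaceP := Wc; rewrite highest_weight_casimir //.
move/matrixP/(_ i a); rewrite mul_mx_diag !mxE mulrC => /eqP.
by rewrite -subr_eq0 -mulrBl mulf_eq0 subr_eq0 (negPf fc) => /eqP.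
Qed.

(* The product kills highest weight vectors; its image is stable, so if it were
   nonzero it would contain one, against [Q^T = Q]. *)
Lemma casimir_split :
  \prod_(c <- undup (codom weight_casimir)) (casimir - c%:M) = 0.
Proof.
set rs := undup _; set Q := \prod_(c <- _) _.
have prod_comm (s : seq R) A : casimir * A = A * casimir ->
    \prod_(c <- s) (casimir - c%:M) * A = A * \prod_(c <- s) (casimir - c%:M).
  move=> cA; elim/big_rec: _ => [|c B _ IH]; first by rewrite mul1r mulr1.
  rewrite -mulrA IH !mulrA; congr (_ * _); rewrite mulrBl mulrBr cA.
  by rewrite -!mulmxE scalar_mxC.
have Qtr : Q^T = Q.
  rewrite /Q; elim: (rs) => [|c s IH]; first by rewrite big_nil trmx1.
  rewrite big_cons -mulmxE trmx_mul IH raddfB /= casimir_tr tr_scalar_mx mulmxBr.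
  by rewrite mulmxBl !mulmxE prod_comm // -!mulmxE scalar_mxC.
have [|W [/submxP[X WX] W0 rW]] := @exists_highest_weight Q.
  by move=> i j _; rewrite mulmxE (prod_comm _ _ (casimir_comm i j)) -mulmxE submxMl.
have WQ : W *m Q = 0.
  (* On highest weight vectors the product acts diagonally, and its entry at [a] vanishes since
     [weight_casimir a] is one of the values [c]. *)
  have hw (s : seq R) (V : 'M[R]_d) :
      (forall i j : 'I_t, (i < j)%N -> V *m E i j = 0) ->
      V *m \prod_(c <- s) (casimir - c%:M) =
      V *m diag_mx (\row_a \prod_(c <- s) (weight_casimir a - c)).
    elim: s V => [|c s IH] V V0.
      rewrite big_nil; congr (_ *m _).
      by apply/matrixP=> a b; rewrite !mxE big_nil.
    rewrite big_cons -mulmxE mulmxA IH => [|i j ij].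
      rewrite mulmxBr highest_weight_casimir // -mulmxBr -mulmxA; congr (_ *m _).
      rewrite -diag_const_mx -raddfB mulmx_diag; congr diag_mx.
      by apply/rowP=> a; rewrite !mxE big_cons.
    rewrite -mulmxA mulmxBl mulmxE casimir_comm -mulmxE -scalar_mxC -mulmxBr.
    by rewrite mulmxA V0 // mul0mx.
  rewrite /Q hw //; apply/matrixP=> i a; rewrite mul_mx_diag !mxE.
  rewrite (bigD1_seq (weight_casimir a)) ?undup_uniq ?mem_undup ?codom_f //=.
  by rewrite subrr mul0r mulr0.
have W00 : W = 0.
  (* As [W = X *m Q] and [Q] is symmetric, [W *m Q = 0] gives [W *m W^T = 0], whose diagonal entries
     are sums of squares. *)
  have XQQ : X *m Q *m Q^T = 0 by rewrite Qtr -WX.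
  apply/matrixP=> i j; rewrite WX [RHS]mxE.
  have /matrixP/(_ i i) : (X *m Q) *m (X *m Q)^T = 0.
    by rewrite trmx_mul mulmxA XQQ mul0mx.
  rewrite [LHS]mxE [RHS]mxE; under eq_bigr do rewrite [in X in _ * X]mxE.
  move/eqP; rewrite psumr_eq0 => [|k _]; last by rewrite -expr2 sqr_ge0.
  by move/allP/(_ j (mem_index_enum _)); rewrite /= mulf_eq0 orbb => /eqP->.
by apply/eqP; rewrite -mxrank_eq0 -leqn0 (leq_trans rW) // W00 mxrank0 muln0.
Qed.
End GlRepresentation.

(** * One-site operators *)

Lemma sum_sym_pairs (V : zmodType) (n : nat) (F : 'I_n -> 'I_n -> V) :
  (forall x y, F x y = F y x) ->
  \sum_x \sum_y F x y =
  \sum_x F x x + (\sum_(x < n) \sum_(y < n | (x < y)%N) F x y) *+ 2.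
Proof.
move=> Fsym.
have -> : \sum_x \sum_y F x y = \sum_(x < n) (F x x +
    (\sum_(y < n | (x < y)%N) F x y + \sum_(y < n | (y < x)%N) F x y)).
  apply: eq_bigr => x _; rewrite (bigD1 x) //=; congr (_ + _).
  rewrite (bigID (fun y : 'I_n => (x < y)%N)) /=.
  congr (_ + _); apply: eq_bigl => y; rewrite -(inj_eq val_inj) /=; by case: ltngtP.
rewrite !big_split /= mulr2n; congr (_ + (_ + _)).
rewrite (exchange_big_dep predT) //=; apply: eq_bigr => y _.
by apply: eq_bigr => x _; rewrite Fsym.
Qed.

Lemma sum_pairs1 (R : numFieldType) n :
  \sum_(x < n) \sum_(y < n | (x < y)%N) 1 = n%:R * (n%:R - 1) / 2 :> R.
Proof.
set c := \sum_(x < n) _.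
have nn : n%:R * n%:R = n%:R + c *+ 2 :> R.
  have := @sum_sym_pairs R n (fun _ _ => 1) (fun _ _ => erefl).
  by rewrite mulr_natr !sumr_const !card_ord.
by rewrite mulrBr nn; field.
Qed.

Section SiteOperators.
Variables (R : realType) (n t : nat).
Local Notation cfg := (config n t).

Definition update (a : cfg) (x : 'I_n) (i : 'I_t) : cfg :=
  [ffun z => if z == x then i else a z].

Definition occupation (a : cfg) (i : 'I_t) : nat := #|[pred x | a x == i]|.

(** Kernels on configurations hide the enumeration that indexes matrices, so that products become
    sums over configurations. *)
Definition kernel_mx (K : cfg -> cfg -> R) : 'M[R]_(dimH n t) :=
  \matrix_(p, q) K (enum_val p) (enum_val q).

Lemma mul_kernel_mx K L :
  kernel_mx K *m kernel_mx L = kernel_mx (fun a c => \sum_b K a b * L b c).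
Proof.
apply/matrixP=> p q; rewrite !mxE; under eq_bigr do rewrite !mxE.
by rewrite -(big_enum_val (fun b => K (enum_val p) b * L b (enum_val q))).
Qed.

(** The elementary matrix [e_ij] on the tensor factor at [x], the identity on the others. *)
Definition site_op (x : 'I_n) (i j : 'I_t) : 'M[R]_(dimH n t) :=
  kernel_mx (fun a b => ((a x == i) && (b == update a x j))%:R).

Lemma mul_site_op x y i j k l : site_op x i j *m site_op y k l =
  kernel_mx (fun a c => [&& a x == i, update a x j y == k &
                          c == update (update a x j) y l]%:R).
Proof.
rewrite mul_kernel_mx; congr kernel_mx; apply/funext=> a; apply/funext=> c.
rewrite (bigD1 (update a x j)) //= eqxx andbT big1 ?addr0 => [|b /negPf->].
  by rewrite -natrM mulnb.
by rewrite andbF mul0r.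
Qed.

Lemma update_id (a : cfg) x : update a x (a x) = a.
Proof. by apply/ffunP=> z; rewrite ffunE; case: eqP => [->|]. Qed.

Lemma update_same (a : cfg) x i : update a x i x = i.
Proof. by rewrite ffunE eqxx. Qed.

Lemma update_neq (a : cfg) x y i : y != x -> update a x i y = a y.
Proof. by rewrite ffunE => /negPf->. Qed.

Lemma update_update (a : cfg) x i j : update (update a x i) x j = update a x j.
Proof. by apply/ffunP=> z; rewrite !ffunE; case: eqP. Qed.

Lemma updateC (a : cfg) x y i j : x != y ->
  update (update a x i) y j = update (update a y j) x i.
Proof.
move=> xy; apply/ffunP=> z; rewrite !ffunE.
by have [->|//] := eqVneq z y; rewrite eq_sym (negPf xy).
Qed.

Lemma mul_site_op_same x i j k l :
  site_op x i j *m site_op x k l = (j == k)%:R *: site_op x i l.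
Proof.
rewrite mul_site_op; apply/matrixP=> p q; rewrite !mxE update_same update_update.
by rewrite andbCA -natrM mulnb.
Qed.

Lemma site_op_comm x y i j k l : x != y ->
  site_op x i j *m site_op y k l = site_op y k l *m site_op x i j.
Proof.
move=> xy; rewrite !mul_site_op; apply/matrixP=> p q; rewrite !mxE.
have yx : y != x by rewrite eq_sym.
by rewrite updateC // (update_neq _ _ yx) (update_neq _ _ xy) andbCA.
Qed.

Lemma site_op_tr x i j : (site_op x i j)^T = site_op x j i.
Proof.
have imp (a b : cfg) k l : (b x == k) && (a == update b x l) ->
    (a x == l) && (b == update a x k).
  by move=> /andP[/eqP<- /eqP->]; rewrite update_same update_update update_id !eqxx.
apply/matrixP=> p q; rewrite !mxE; congr (nat_of_bool _)%:R.
by apply/idP/idP=> /imp.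
Qed.

Lemma sum_site_op_diag x : \sum_i site_op x i i = 1%:M.
Proof.
apply/matrixP=> p q; rewrite summxE !mxE (bigD1 (enum_val p x)) //= mxE eqxx.
rewrite update_id (inj_eq enum_val_inj) eq_sym big1 ?addr0 // => i /negPf ix.
by rewrite mxE eq_sym ix.
Qed.

Definition total_op (i j : 'I_t) : 'M[R]_(dimH n t) := \sum_x site_op x i j.

(** Operators at distinct sites commute, so the brackets come from equal sites only. *)
Lemma total_op_commutator i j k l : total_op i j * total_op k l =
  total_op k l * total_op i j
  + (j == k)%:R *: total_op i l - (l == i)%:R *: total_op k j.
Proof.
rewrite -!mulmxE /total_op !mulmx_suml.
under eq_bigr do rewrite mulmx_sumr.
under [X in _ = X + _ - _]eq_bigr do rewrite mulmx_sumr.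
rewrite [X in _ = X + _ - _]exchange_big /= !scaler_sumr -big_split -sumrB /=.
apply: eq_bigr => x _; rewrite (bigD1 x) //= [X in _ = X + _ - _](bigD1 x) //=.
rewrite !mul_site_op_same.
rewrite (eq_bigr (fun y => site_op y k l *m site_op x i j)) => [|y yx].
  set A := (j == k)%:R *: _; set B := (l == i)%:R *: _; set S := \sum_(y | _) _.
  by rewrite [RHS]addrAC [B + S]addrC addrK addrC.
by rewrite site_op_comm // eq_sym.
Qed.

Lemma total_op_tr i j : (total_op i j)^T = total_op j i.
Proof.
by rewrite /total_op raddf_sum; apply: eq_bigr => x _; rewrite /= site_op_tr.
Qed.

Lemma total_op_diag i :
  total_op i i = diag_mx (\row_p (occupation (enum_val p) i)%:R).
Proof.
apply/matrixP=> p q; rewrite summxE !mxE.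
have -> : occupation (enum_val p) i = (\sum_(x in [pred x | (enum_val p : cfg) x == i]) 1)%N.
  by rewrite sum1_card.
rewrite natr_sum.
rewrite -sumrMnl [RHS]big_mkcond /=; apply: eq_bigr => x _; rewrite mxE inE.
case: eqP => //= <-; rewrite update_id (inj_eq enum_val_inj) eq_sym.
by case: (p == q).
Qed.

Lemma occupation_update (a : cfg) x i : a x != i ->
  occupation (update a x i) i = (occupation a i).+1.
Proof.
move=> axi; rewrite /occupation (cardD1 x) inE update_same eqxx; congr S.
apply: eq_card => y; rewrite !inE.
by have [->|yx] := eqVneq y x; [rewrite (negPf axi) | rewrite update_neq].
Qed.

Lemma occupation_le (a : cfg) i : (occupation a i <= n)%N.
Proof. by rewrite (leq_trans (max_card _)) ?card_ord. Qed.

(** Read from row to column, each factor turns one site from state [i] to state [j]. A nonzero entry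
    of the [r]-th power thus raises the occupation of [j] by [r], and no occupation exceeds [n]. *)
Lemma total_op_nilpotent i j : i != j -> total_op i j ^+ n.+1 = 0.
Proof.
move=> ij.
have H r p q : (total_op i j ^+ r) p q != 0 ->
    occupation (enum_val q) j = (occupation (enum_val p) j + r)%N.
  elim: r q => [|r IH] q.
    by rewrite expr0 mxE addn0; have [->|_] := eqVneq p q; rewrite ?eqxx.
  apply: contraNeq => neq; rewrite exprSr -mulmxE mxE big1 // => s _.
  have [->|/IH Es] := eqVneq ((total_op i j ^+ r) p s) 0; first by rewrite mul0r.
  suff -> : total_op i j s q = 0 by rewrite mulr0.
  rewrite summxE big1 // => x _; rewrite mxE; case: andP => //= -[/eqP sx /eqP qE].
  by move/eqP: neq; case; rewrite qE occupation_update ?sx // Es addnS.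
apply/matrixP=> p q; rewrite [RHS]mxE; apply/eqP; apply: contraT => /H.
have := occupation_le (enum_val q) j; move=> + E; rewrite E.
by rewrite addnS ltnNge leq_addl.
Qed.

(** In the row of [a] only [i = a x] and [j = a y] contribute, and that term exchanges the two
    states. *)
Lemma swap_site_op x y : x != y ->
  \sum_i \sum_j site_op x i j *m site_op y j i = Tmat R t x y.
Proof.
move=> xy; have yx : y != x by rewrite eq_sym.
apply/matrixP=> p q; rewrite summxE mxE.
set a : cfg := enum_val p; set c : cfg := enum_val q.
rewrite (bigD1 (a x)) //= summxE [X in _ + X]big1 ?addr0 => [|i ai]; last first.
  rewrite summxE big1 // => j _; rewrite mul_site_op mxE.
  by rewrite -/a eq_sym (negPf ai).
rewrite (bigD1 (a y)) //= [X in _ + X]big1 ?addr0 => [|j aj]; last first.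
  by rewrite mul_site_op mxE (update_neq _ _ yx) -/a (eq_sym (a y)) (negPf aj) andbF.
rewrite mul_site_op mxE -/a -/c (update_neq _ _ yx) !eqxx /=.
have -> : update (update a x (a y)) y (a x) = [ffun z => a (tperm x y z)].
  apply/ffunP=> z; rewrite !ffunE; case: tpermP => [->|->|/eqP zx /eqP zy].
  - by rewrite (negPf xy) eqxx.
  - by rewrite eqxx.
  - by rewrite (negPf zx) (negPf zy).
congr (nat_of_bool _)%:R; apply/eqP/eqP => ->; apply/ffunP=> z.
  by rewrite !ffunE tpermK.
by rewrite !ffunE tpermK.
Qed.

Lemma Tmat_sym (x y : 'I_n) : Tmat R t x y = Tmat R t y x.
Proof. by apply/matrixP=> p q; rewrite !mxE tpermC. Qed.

(** Equal sites contribute [\sum_(i, j) e_ij e_ji = t] each; distinct sites contribute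
    transpositions, every unordered pair twice. *)
Lemma casimir_total_op : casimir total_op =
  ((n * t)%:R)%:M + (\sum_(x < n) \sum_(y < n | (x < y)%N) Tmat R t x y) *+ 2.
Proof.
pose F (x y : 'I_n) : 'M[R]_(dimH n t) := if x == y then (t%:R)%:M else Tmat R t x y.
have -> : casimir total_op = \sum_x \sum_y F x y.
  rewrite /casimir /total_op.
  under eq_bigr => i _ do under eq_bigr => j _ do
    (rewrite -mulmxE mulmx_suml; under eq_bigr do rewrite mulmx_sumr).
  under eq_bigr => i _ do rewrite exchange_big /=.
  rewrite exchange_big; apply: eq_bigr => x _ /=.
  under eq_bigr => i _ do rewrite exchange_big /=.
  rewrite exchange_big; apply: eq_bigr => y _ /=.
  rewrite /F; have [<-|xy] := eqVneq x y; last exact: swap_site_op.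
  under eq_bigr => i _ do under eq_bigr => j _ do
    rewrite mul_site_op_same eqxx scale1r.
  under eq_bigr do rewrite sumr_const card_ord.
  by rewrite sumrMnl sum_site_op_diag [RHS]raddfMn.
rewrite sum_sym_pairs => [|x y]; last by rewrite /F eq_sym; case: eqP => // _; exact: Tmat_sym.
congr (_ + _ *+ 2).
  under eq_bigr do rewrite /F eqxx.
  by rewrite sumr_const card_ord mulnC natrM mulr_natr [RHS]raddfMn.
apply: eq_bigr => x _; apply: eq_bigr => y xy; rewrite /F.
by rewrite -(inj_eq val_inj) /= ltn_eqF.
Qed.

End SiteOperators.

(** * Exponential traces *)

Lemma mpowE (R : realType) (d : nat) (A : 'M[R]_d) k : mpow A k = A ^+ k.
Proof. by elim: k => //= k IH; rewrite exprS -IH. Qed.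

Lemma cvg_exp_series (R : realType) (x : R) :
  (fun m : nat => \sum_(0 <= k < m) (x ^+ k / k`!%:R)) @ \oo --> expR x.
Proof. exact: (is_cvg_series_exp_coeff x). Qed.

Lemma cvg_sum_fin (R : realType) (T : Type) (F : set_system T) (FF : Filter F)
    (I : finType) (f : I -> T -> R) (l : I -> R) :
  (forall i, f i x @[x --> F] --> l i) ->
  \sum_i f i x @[x --> F] --> \sum_i l i.
Proof. by move=> fl; apply: cvg_big => //; exact: add_continuous. Qed.

Lemma conj_diagX (F : fieldType) (d : nat) (P A : 'M[F]_d) (D : 'rV_d) k :
  P \in unitmx -> P *m A = diag_mx D *m P ->
  A ^+ k = invmx P *m diag_mx (\row_i D ord0 i ^+ k) *m P.
Proof.
move=> Pu PA; elim: k => [|k IH].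
  suff -> : diag_mx (\row_i D ord0 i ^+ 0) = 1%:M by rewrite mulmx1 mulVmx.
  by apply/matrixP=> i j; rewrite !mxE expr0.
rewrite exprSr -mulmxE IH -[_ *m P *m A]mulmxA PA mulmxA; congr (_ *m P).
by rewrite -mulmxA mulmx_diag; congr (_ *m diag_mx _); apply/rowP=> i; rewrite !mxE exprSr.
Qed.

Section TraceExponential.
Variables (R : realType) (d : nat) (P A : 'M[R]_d) (D : 'rV[R]_d).
Hypotheses (P_unit : P \in unitmx) (PA : P *m A = diag_mx D *m P).

(** The partial sums of each entry are fixed linear combinations of scalar exponential series, so
    the [limn] in [mexp] is a genuine limit. *)
Lemma mexp_conj_diag : mexp A = invmx P *m diag_mx (\row_i expR (D ord0 i)) *m P.
Proof.
apply/matrixP=> i j; rewrite mxE.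
have -> : (invmx P *m diag_mx (\row_i expR (D ord0 i)) *m P) i j =
    \sum_l (invmx P i l * P l j) * expR (D ord0 l).
  by rewrite !mxE; apply: eq_bigr => l _; rewrite mul_mx_diag !mxE mulrAC.
apply/cvg_lim => //.
rewrite (_ : (fun m : nat => _) = fun m : nat =>
    \sum_l (invmx P i l * P l j) * \sum_(0 <= k < m) (D ord0 l ^+ k / k`!%:R)).
  by apply: cvg_sum_fin => l; apply: cvgMr; exact: cvg_exp_series.
apply/funext=> m; under [RHS]eq_bigr do rewrite mulr_sumr.
rewrite exchange_big; apply: eq_bigr => k _ /=.
rewrite mpowE (conj_diagX _ P_unit PA) mxE mulr_suml; apply: eq_bigr => l _.
by rewrite mul_mx_diag !mxE -!mulrA; congr (_ * _); rewrite mulrCA.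
Qed.

Lemma trace_mexp_conj_diag : \tr (mexp A) = \sum_i expR (D ord0 i).
Proof.
rewrite mexp_conj_diag mxtrace_mulC mulmxA mulmxV // mul1mx mxtrace_diag.
by apply: eq_bigr => i _; rewrite mxE.
Qed.

Lemma trace_conj_diagX k : \tr (A ^+ k) = \sum_i D ord0 i ^+ k.
Proof.
rewrite (conj_diagX _ P_unit PA) mxtrace_mulC mulmxA mulmxV // mul1mx mxtrace_diag.
by apply: eq_bigr => i _; rewrite mxE.
Qed.

End TraceExponential.

(** Of the nonnegative sum over closed paths from [p], only the constant path is kept. *)
Lemma le_diag_exprmx (R : realType) (d : nat) (B : 'M[R]_d) k p :
  (forall i j, 0 <= B i j) -> B p p ^+ k <= (B ^+ k) p p.
Proof.
move=> B0; have BX0 r i j : 0 <= (B ^+ r) i j.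
  elim: r i j => [|r IH] i j; first by rewrite expr0 mxE ler0n.
  by rewrite exprS -mulmxE mxE sumr_ge0 // => l _; rewrite mulr_ge0.
elim: k => [|k IH]; first by rewrite !expr0 mxE eqxx.
rewrite !exprS -mulmxE mxE (bigD1 p) //=; apply: (le_trans (y := B p p * (B ^+ k) p p)).
  by rewrite ler_wpM2l.
by rewrite lerDl sumr_ge0 // => l _; rewrite mulr_ge0.
Qed.

(* After a shift making all entries nonnegative, Peierls' inequality follows
   term by term from [B p p ^+ k <= (B ^+ k) p p]. *)
Lemma peierls (R : realType) (d : nat) (P A : 'M[R]_d) (D : 'rV[R]_d) (b : R) :
  P \in unitmx -> P *m A = diag_mx D *m P ->
  (forall i j, 0 <= (A + b%:M) i j) ->
  \sum_p expR (A p p) <= \tr (mexp A).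
Proof.
move=> Pu PA B0; set B := A + b%:M in B0.
have PB : P *m B = diag_mx (D + const_mx b) *m P.
  by rewrite mulmxDr PA scalar_mxC -mulmxDl raddfD /= diag_const_mx.
rewrite (trace_mexp_conj_diag Pu PA).
have shift (u : 'I_d -> R) :
    \sum_p expR (u p) = expR (- b) * \sum_p expR (u p + b).
  by rewrite mulr_sumr; apply: eq_bigr => p _; rewrite -expRD addrC addrK.
rewrite (shift (fun p => A p p)) (shift (fun p => D ord0 p)) ler_wpM2l ?expR_ge0 //.
have cvgS (u : 'I_d -> R) : (fun m : nat => \sum_(0 <= k < m) \sum_p
    (u p ^+ k / k`!%:R)) @ \oo --> \sum_p expR (u p).
  under eq_fun do rewrite exchange_big.
  by apply: cvg_sum_fin => p; exact: cvg_exp_series.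
apply: (ler_cvg_to (cvgS (fun p => A p p + b)) (cvgS (fun p => D ord0 p + b))).
apply: nearW => m; apply: ler_sum => k _; rewrite -!mulr_suml ler_wpM2r ?invr_ge0 //.
have -> : \sum_i (D ord0 i + b) ^+ k = \tr (B ^+ k).
  by rewrite (trace_conj_diagX Pu PB); apply: eq_bigr => i _; rewrite !mxE.
apply: ler_sum => p _; apply: le_trans (le_diag_exprmx k p B0).
by rewrite !mxE eqxx.
Qed.

Lemma ler_sum_of_card (R : realFieldType) (T : eqType) (I J : finType) (K : nat)
    (f : I -> T) (h : J -> T) (g : T -> R) :
  (forall c, 0 <= g c) ->
  (forall c, (#|[pred i | f i == c]| <= K * #|[pred j | h j == c]|)%N) ->
  \sum_i g (f i) <= K%:R * \sum_j g (h j).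
Proof.
move=> g0 fh; pose N c := #|[pred j | h j == c]|.
have fN i : (0 < N (f i))%N.
  have : (0 < K * N (f i))%N.
    by apply: leq_trans (fh _); apply/card_gt0P; exists i; rewrite inE.
  by rewrite muln_gt0 => /andP[].
(* The term of [i] is shared equally among the [N (f i)] indices [j] with the same value. *)
have -> : \sum_i g (f i) = \sum_j \sum_(i | f i == h j) g (h j) / (N (h j))%:R.
  rewrite (exchange_big_dep predT) //=; apply: eq_bigr => i _.
  rewrite (eq_bigr (fun=> g (f i) / (N (f i))%:R)) => [|j /eqP->//].
  rewrite sumr_const (eq_card (B := [pred j | h j == f i])) => [|j].
    by rewrite -[RHS]mulr_natr -/(N (f i)) divfK // pnatr_eq0 -lt0n fN.
  by rewrite !inE eq_sym.
rewrite mulr_sumr; apply: ler_sum => j _; rewrite sumr_const.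
rewrite -[X in X <= _]mulr_natr mulrAC -mulrA mulrC ler_wpM2r // ler_pdivrMr; last first.
  by rewrite ltr0n; apply/card_gt0P; exists j; rewrite inE.
by rewrite -natrM ler_nat; exact: fh.
Qed.

(** * Comparison of the partition function with classical sums *)

Section PartitionFunctionBounds.
Variables (R : realType) (n t : nat) (beta : R).
Hypothesis n_gt0 : (0 < n)%N.
Local Notation cfg := (config n t).
Local Notation A := (- (beta / n%:R) *: Hn R n t).

Definition highest_energy (a : cfg) : R := \sum_i (occupation a i)%:R ^+ 2
  - \sum_(i < t) \sum_(j < t | (i < j)%N) ((occupation a i)%:R - (occupation a j)%:R).

(** In the constant, [t%:R] comes from the equal sites in the Casimir element and [n%:R - 1] from
    the number of edges. *)
Lemma hamiltonian_casimir : A = (beta / (2 * n%:R)) *: casimir (@total_op R n t)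
  - (beta / 2 * (t%:R + n%:R - 1))%:M.
Proof.
pose S : 'M[R]_(dimH n t) := \sum_(x < n) \sum_(y < n | (x < y)%N) Tmat R t x y.
pose c : R := \sum_(x < n) \sum_(y < n | (x < y)%N) 1.
have -> : Hn R n t = - (S - c%:M).
  rewrite /Hn; congr (- _); rewrite /S /c.
  under eq_bigr do rewrite sumrB.
  rewrite sumrB; congr (_ - _); rewrite raddf_sum; apply: eq_bigr => x _.
  by rewrite raddf_sum.
have n0 : n%:R != 0 :> R by rewrite pnatr_eq0 -lt0n.
rewrite casimir_total_op -/S; apply/matrixP=> p q; rewrite !mxE /c sum_pairs1 natrM.
by case: (p == q); rewrite ?mulr1n ?mulr0n; field.
Qed.

(** The multiplicity of an eigenvalue [c] of the Casimir element is at most the dimension of its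
    eigenspace, hence at most [n.+1 ^ (t * t * t)] times the number of configurations with
    [highest_energy] equal to [c]. *)
Lemma diagonalization : exists (P : 'M[R]_(dimH n t)) (D : 'rV[R]_(dimH n t)),
  [/\ P \in unitmx, P *m A = diag_mx D *m P &
    \sum_i expR (D ord0 i) <= (n.+1 ^ (t * t * t))%:R *
      \sum_(a : cfg) expR (beta / (2 * n%:R) * highest_energy a
                             - beta / 2 * (t%:R + n%:R - 1))].
Proof.
pose w (i : 'I_t) : 'rV[R]_(dimH n t) := \row_p (occupation (enum_val p) i)%:R.
have split := casimir_split (@total_op_commutator R n t) (@total_op_nilpotent R n t)
  (@total_op_tr R n t) (w := w) (@total_op_diag R n t).
have [P [D [Pu PC]]] := split_simple_diagonalizable (undup_uniq _) split.
set u := beta / (2 * n%:R); set v := beta / 2 * _.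
exists P, (u *: D - const_mx v); split=> //.
  rewrite hamiltonian_casimir mulmxBr -scalemxAr PC scalar_mxC scalemxAl -mulmxBl.
  by rewrite raddfB /= diag_const_mx linearZ.
pose g c := expR (u * c - v).
have := @ler_sum_of_card R _ _ _ (n.+1 ^ (t * t * t)) (fun i => D ord0 i)
  (fun p => weight_casimir w p) g (fun c => expR_ge0 _).
have -> : \sum_(a : cfg) expR (u * highest_energy a - v) =
    \sum_p g (weight_casimir w p).
  rewrite (big_enum_val (fun a : cfg => expR (u * highest_energy a - v))) /=.
  apply: eq_bigr => p _; rewrite /g.
  suff -> : weight_casimir w p = highest_energy (enum_val p) by [].
  rewrite /weight_casimir /highest_energy; apply: f_equal2.
    by apply: eq_bigr => i _; rewrite mxE.
  apply: f_equal; apply: eq_bigr => i _; apply: eq_bigr => j _; by rewrite !mxE.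
under eq_bigr do rewrite /g.
under [X in _ -> X <= _]eq_bigr do rewrite !mxE.
apply=> c; apply: leq_trans (card_diag_eigenvalue c Pu PC) _.
exact: rank_eigenspace_casimir (@total_op_commutator R n t)
  (@total_op_nilpotent R n t) (@total_op_diag R n t) c.
Qed.

Lemma Zn_upper : Zn t beta n <= (n.+1 ^ (t * t * t))%:R *
  \sum_(a : cfg) expR (beta / (2 * n%:R) * highest_energy a
                         - beta / 2 * (t%:R + n%:R - 1)).
Proof.
by have [P [D [Pu PA le]]] := diagonalization; rewrite /Zn (trace_mexp_conj_diag Pu PA).
Qed.

(** Peierls' inequality in the basis of configurations, where the diagonal entry of a transposition
    at [a] is 1 if [a x = a y]. *)
Lemma Zn_lower : 0 < beta ->
  \sum_(a : cfg) expR (beta / n%:R *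
    \sum_(x < n) \sum_(y < n | (x < y)%N) ((a x == a y)%:R - 1)) <= Zn t beta n.
Proof.
move=> b0; have [P [D [Pu PA _]]] := diagonalization.
pose c : R := \sum_(x < n) \sum_(y < n | (x < y)%N) 1.
have AE p q : A p q = beta / n%:R * \sum_(x < n) \sum_(y < n | (x < y)%N)
    (Tmat R t x y p q - (p == q)%:R).
  rewrite /Hn scaleNr scalerN opprK mxE summxE; congr (_ * _).
  by apply: eq_bigr => x _; rewrite summxE; apply: eq_bigr => y _; rewrite !mxE.
(* Adding [beta / n%:R] for each edge cancels the identities in the Hamiltonian and leaves the
   nonnegative entries of the transpositions. *)
have B0 p q : 0 <= (A + (beta / n%:R * c)%:M) p q.
  rewrite mxE AE [X in _ + X]mxE -mulrnAr -mulrDr mulr_ge0 //.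
    by rewrite divr_ge0 // ltW.
  rewrite -sumrMnl -big_split sumr_ge0 // => x _.
  rewrite -sumrMnl -big_split sumr_ge0 // => y _ /=.
  by rewrite mxE subrK ler0n.
apply: le_trans (peierls Pu PA B0).
rewrite (big_enum_val (fun a : cfg => expR (beta / n%:R *
  \sum_(x < n) \sum_(y < n | (x < y)%N) ((a x == a y)%:R - 1)))) /=.
apply: ler_sum => p _; rewrite AE ler_expR.
rewrite ler_wpM2l ?divr_ge0 ?(ltW b0) //.
apply: ler_sum => x _; apply: ler_sum => y _; rewrite mxE eqxx lerB // ler_nat.
case: eqP => // xy; rewrite (_ : (_ == _) = true) //; apply/eqP/ffunP=> z.
by rewrite ffunE; case: tpermP => [->|->|].
Qed.

End PartitionFunctionBounds.

(** * Lower bound *)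

Section Simplex.
Variables (R : realType) (t : nat).

(** The ordering in [Delta] is dropped, since empirical frequencies come unsorted; [phi] is
    symmetric, so the maximum is the same. *)
Definition simplex (x : 'I_t -> R) := (forall j, 0 <= x j) /\ \sum_j x j = 1.

Lemma simplex_le1 x j : simplex x -> x j <= 1.
Proof.
by case=> x0 <-; rewrite (bigD1 j) //= lerDl sumr_ge0.
Qed.

Lemma simplex_sqr_le1 x : simplex x -> \sum_j x j ^+ 2 <= 1.
Proof.
move=> sx; case: (sx) => x0 <-; apply: ler_sum => j _.
by rewrite expr2 ler_piMr ?simplex_le1.
Qed.

Lemma xlogxE (u : R) : xlogx u = u * ln u.
Proof. by rewrite /xlogx; case: eqP => [->|//]; rewrite mul0r. Qed.

End Simplex.

(** The tangent bound [1 + u <= expR u] is averaged around the mean [m], where the linear term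
    vanishes. *)
Lemma gibbs_ineq (R : realType) (I : finType) (p h : I -> R) :
  (forall i, 0 <= p i) -> \sum_i p i = 1 ->
  expR (\sum_i p i * (h i - ln (p i))) <= \sum_i expR (h i).
Proof.
move=> p0 p1; set m := \sum_i _.
have -> : expR m = \sum_i p i * (expR m * (1 + (h i - ln (p i) - m))).
  under eq_bigr do rewrite mulrCA.
  rewrite -mulr_sumr -[LHS]mulr1; congr (_ * _).
  under eq_bigr do rewrite mulrDr mulr1 mulrBr.
  by rewrite big_split /= sumrB -mulr_suml p1 -/m mul1r subrr addr0.
apply: ler_sum => i _; have := p0 i; rewrite le_eqVlt => /orP[/eqP<-|pi0].
  by rewrite mul0r expR_ge0.
have -> : expR (h i) = p i * (expR m * expR (h i - ln (p i) - m)).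
  by rewrite -expRD addrC subrK expRD expRN lnK // mulrC divfK // gt_eqF.
by rewrite !ler_wpM2l ?expR_ge0 ?expR_ge1Dx // ltW.
Qed.

Section ProductMeasure.
Variables (R : realType) (n t : nat) (x : 'I_t -> R).
Hypothesis sx : simplex x.
Local Notation cfg := (config n t).

Definition product_weight (a : cfg) : R := \prod_z x (a z).

Lemma product_weight_ge0 a : 0 <= product_weight a.
Proof. by apply: prodr_ge0 => z _; apply: sx.1. Qed.

(** Independence of the sites; total mass, marginals and collision probabilities follow by choosing
    [G]. *)
Lemma product_weight_distr (G : 'I_n -> 'I_t -> R) :
  \sum_a product_weight a * \prod_z G z (a z) = \prod_z \sum_j x j * G z j.
Proof. by rewrite bigA_distr_bigA; apply: eq_bigr => a _; rewrite -big_split. Qed.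

Lemma product_weight_sum : \sum_a product_weight a = 1.
Proof.
transitivity (\sum_a product_weight a * \prod_(z < n) 1).
  by apply: eq_bigr => a _; rewrite big1 // mulr1.
rewrite (product_weight_distr (fun _ _ => 1)).
by rewrite big1 // => z _; under eq_bigr do rewrite mulr1; exact: sx.2.
Qed.

Lemma product_weight_marginal z (g : 'I_t -> R) :
  \sum_a product_weight a * g (a z) = \sum_j x j * g j.
Proof.
transitivity (\sum_a product_weight a * \prod_u (if u == z then g (a u) else 1)).
  by apply: eq_bigr => a _; rewrite -big_mkcond big_pred1_eq.
rewrite (product_weight_distr (fun u i => if u == z then g i else 1)).
rewrite (bigD1 z) //= eqxx [X in _ * X]big1 ?mulr1 // => u /negPf->.
by under eq_bigr do rewrite mulr1; exact: sx.2.
Qed.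

Lemma product_weight_collision z y : z != y ->
  \sum_a product_weight a * (a z == a y)%:R = \sum_j x j ^+ 2.
Proof.
move=> zy.
have H j := product_weight_distr (fun u i =>
  if (u == z) || (u == y) then (i == j)%:R else 1).
transitivity (\sum_j \sum_(a : cfg) product_weight a * ((a z == j)%:R * (a y == j)%:R)).
  rewrite exchange_big; apply: eq_bigr => a _ /=; rewrite -mulr_sumr; congr (_ * _).
  rewrite (bigD1 (a z)) //= eqxx mul1r big1 ?addr0 1?eq_sym // => j ja.
  by rewrite eq_sym (negPf ja) mul0r.
apply: eq_bigr => j _; have yz : y != z by rewrite eq_sym.
have prod_zy (f : 'I_n -> R) :
    (forall u, u != z -> u != y -> f u = 1) -> \prod_u f u = f z * f y.
  move=> f1; rewrite (bigD1 z) //= (bigD1 y) //= big1 ?mulr1 // => u /andP[].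
  exact: f1.
have mass : \sum_i x i * (i == j)%:R = x j.
  rewrite (bigD1 j) //= eqxx mulr1 big1 ?addr0 // => i /negPf->.
  by rewrite mulr0.
transitivity (\sum_(a : cfg) product_weight a * \prod_u
    (if (u == z) || (u == y) then (a u == j)%:R else 1)).
  apply: eq_bigr => a _; congr (_ * _); rewrite prod_zy ?eqxx ?orbT //.
  by move=> u /negPf-> /negPf->.
rewrite H prod_zy => [|u /negPf-> /negPf->].
  by rewrite !eqxx orbT /= mass expr2.
by under eq_bigr do rewrite mulr1; exact: sx.2.
Qed.

Lemma product_weight_entropy :
  \sum_a product_weight a * ln (product_weight a) = n%:R * \sum_j xlogx (x j).
Proof.
have E a : product_weight a * ln (product_weight a) =
    \sum_z product_weight a * ln (x (a z)).
  (* A configuration of weight zero contributes 0 to both sides; otherwise every factor is positive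
     and the logarithm of the product splits. *)
  have := product_weight_ge0 a; rewrite le_eqVlt => /orP[/eqP<-|a0].
    by rewrite mul0r big1 // => z _; rewrite mul0r.
  have xa z : 0 < x (a z).
    rewrite lt_neqAle sx.1 andbT; apply: contraTneq a0 => xz.
    by rewrite /product_weight (bigD1 z) //= -xz mul0r ltxx.
  rewrite -mulr_sumr; congr (_ * _); rewrite /product_weight.
  rewrite -[RHS]expRK expR_sum; congr ln; apply: eq_bigr => z _.
  by rewrite lnK ?posrE.
under eq_bigr do rewrite E.
rewrite exchange_big /= (eq_bigr (fun=> \sum_j xlogx (x j))) => [|z _].
  by rewrite sumr_const card_ord mulr_natl.
rewrite (product_weight_marginal z (fun j => ln (x j))).
by apply: eq_bigr => j _; rewrite xlogxE.
Qed.

End ProductMeasure.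

(** The mean energy carries [n%:R - 1] instead of [n%:R]. This only helps, because
    [\sum_j x j ^+ 2 <= 1], so the bound has no error term. *)
Lemma ln_Zn_lower (R : realType) (n t : nat) (beta : R) (x : 'I_t -> R) :
  (0 < n)%N -> 0 < beta -> simplex x -> phi t beta x <= ln (Zn t beta n) / n%:R.
Proof.
move=> n0 b0 sx; rewrite ler_pdivlMr ?ltr0n //.
pose h (a : config n t) : R := beta / n%:R *
    \sum_(x < n) \sum_(y < n | (x < y)%N) ((a x == a y)%:R - 1).
have hm : \sum_a product_weight x a * h a =
    beta / 2 * (n%:R - 1) * (\sum_j x j ^+ 2 - 1).
  rewrite /h; under eq_bigr do rewrite mulrCA mulr_sumr.
  rewrite -mulr_sumr exchange_big /=.
  under eq_bigr do (under eq_bigr do rewrite mulr_sumr; rewrite exchange_big /=).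
  rewrite (eq_bigr (fun z : 'I_n => \sum_(y < n | (z < y)%N)
      1 * (\sum_j x j ^+ 2 - 1))) => [|z _].
    under eq_bigr do rewrite -mulr_suml.
    rewrite -mulr_suml sum_pairs1; field.
    by rewrite pnatr_eq0 -lt0n.
  apply: eq_bigr => y zy; under eq_bigr do rewrite mulrBr mulr1.
  rewrite sumrB product_weight_sum // product_weight_collision ?mul1r //.
  by rewrite -(inj_eq val_inj) /= ltn_eqF.
have : expR (\sum_a product_weight x a * (h a - ln (product_weight x a)))
    <= Zn t beta n.
  apply: le_trans (Zn_lower t n0 b0); apply: gibbs_ineq.
    by move=> a; exact: product_weight_ge0.
  exact: product_weight_sum.
under eq_bigr do rewrite mulrBr.
rewrite sumrB hm product_weight_entropy // => le.
have Z0 : 0 < Zn t beta n by apply: lt_le_trans le; exact: expR_gt0.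
apply: le_trans (_ : _ <= ln (expR _)) _; last by rewrite ler_ln ?posrE ?expR_gt0; first exact: le.
rewrite expRK /phi mulrBl (mulrC n%:R) lerD2r -mulrA mulrAC -!mulrA ler_pM2l //.
rewrite mulrC -!mulrA ler_pM2l ?invr_gt0 ?ltr0n //.
have := simplex_sqr_le1 sx; set q := \sum_j _ => q1.
by nra.
Qed.

(** * Upper bound *)

Section UpperBound.
Variables (R : realType) (n t : nat) (beta : R).
Hypotheses (n_gt0 : (0 < n)%N) (beta_gt0 : 0 < beta).
Local Notation cfg := (config n t).

Lemma sum_occupation (a : cfg) (g : 'I_t -> R) :
  \sum_z g (a z) = \sum_j (occupation a j)%:R * g j.
Proof.
rewrite (partition_big a predT) //=; apply: eq_bigr => j _.
rewrite (eq_bigr (fun=> g j)) => [|z /eqP->//].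
by rewrite sumr_const mulr_natl.
Qed.

Lemma occupation_sum (a : cfg) : (\sum_j occupation a j = n)%N.
Proof.
rewrite -[RHS]card_ord -sum1_card (partition_big a predT) //=.
by apply: eq_bigr => j _; rewrite sum1_card.
Qed.

Definition frequency (a : cfg) (j : 'I_t) : R := (occupation a j)%:R / n%:R.

Let n_neq0 : n%:R != 0 :> R. Proof. by rewrite pnatr_eq0 -lt0n. Qed.

Lemma simplex_frequency a : simplex (frequency a).
Proof.
split=> [j|]; first by rewrite divr_ge0.
by rewrite -mulr_suml -natr_sum occupation_sum divff.
Qed.

Lemma frequency_gt0 (a : cfg) z : 0 < frequency a (a z).
Proof.
rewrite divr_gt0 ?ltr0n //; apply/card_gt0P; exists z; by rewrite inE.
Qed.

(** Each of the at most [t] copies of [- (n_i - n_j)] with a given [j] is bounded by [n_j], and the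
    occupations sum to [n]. *)
Lemma highest_energy_le (a : cfg) :
  highest_energy R a <= \sum_j (occupation a j)%:R ^+ 2 + t%:R * n%:R.
Proof.
rewrite lerD2l -sumrN.
have -> : t%:R * n%:R = \sum_(i < t) \sum_(j < t) (occupation a j)%:R :> R.
  by rewrite -natr_sum occupation_sum sumr_const card_ord mulr_natl.
apply: ler_sum => i _; rewrite -sumrN big_mkcond; apply: ler_sum => j _ /=.
by case: ifP => _; rewrite ?ler0n // opprB gerBl ler0n.
Qed.

(** Under its own empirical distribution [a] has weight [expR (n%:R * \sum_j xlogx (frequency a
    j))], the inverse of the entropy factor in [expR (n%:R * phi t beta (frequency a))]. *)
Lemma boltzmann_le (M : R) (a : cfg) :
  (forall x, simplex x -> phi t beta x <= M) ->
  expR (beta / (2 * n%:R) * highest_energy R a - beta / 2 * (t%:R + n%:R - 1))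
  <= expR (n%:R * M + beta / 2) * product_weight (frequency a) a.
Proof.
move=> leM.
have -> : product_weight (frequency a) a = expR (n%:R * \sum_j xlogx (frequency a j)).
  rewrite mulr_sumr (eq_bigr (fun j => (occupation a j)%:R * ln (frequency a j))) => [|j _].
    rewrite -sum_occupation expR_sum; apply: eq_bigr => z _.
    by rewrite lnK // posrE frequency_gt0.
  by rewrite xlogxE mulrA; congr (_ * _); rewrite mulrC divfK.
rewrite -expRD ler_expR.
have := leM _ (simplex_frequency a); rewrite /phi.
set L := \sum_j xlogx _; set Q := \sum_j _ ^+ 2 => h.
have QE : \sum_j (occupation a j)%:R ^+ 2 = n%:R ^+ 2 * Q.
  rewrite mulr_sumr; apply: eq_bigr => j _; rewrite /frequency.
  by rewrite -exprMn mulrC divfK.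
have := highest_energy_le a; rewrite QE => h2.
apply: le_trans (_ : beta / (2 * n%:R) * (n%:R ^+ 2 * Q + t%:R * n%:R)
   - beta / 2 * (t%:R + n%:R - 1) <= _).
  by rewrite lerD2r ler_wpM2l // divr_ge0 ?mulr_ge0 // ltW.
(* The bound [t%:R * n%:R] on the linear term cancels the [t%:R] of the constant exactly, leaving
   only [beta / 2]. *)
have -> : beta / (2 * n%:R) * (n%:R ^+ 2 * Q + t%:R * n%:R)
   - beta / 2 * (t%:R + n%:R - 1) = n%:R * (beta / 2 * (Q - 1)) + beta / 2.
  by field.
rewrite addrAC lerD2r -mulrDr ler_wpM2l //; lra.
Qed.

(* Each empirical distribution is one of at most [n.+1 ^ t] grid points, and
   the product weights of a fixed grid point sum to 1. *)
Lemma sum_empirical_weight :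
  \sum_(a : cfg) product_weight (frequency a) a <= (n.+1 ^ t)%:R.
Proof.
pose G := {ffun 'I_t -> 'I_n.+1}.
pose y (nu : G) (j : 'I_t) : R := (nu j)%:R / n%:R.
pose ok (nu : G) := (\sum_j nu j == n)%N.
pose nua (a : cfg) : G := [ffun j => inord (occupation a j)].
have nuaE a j : nua a j = occupation a j :> nat.
  by rewrite ffunE inordK // ltnS occupation_le.
have sy nu : ok nu -> simplex (y nu).
  move=> /eqP nuE; split=> [j|]; first by rewrite divr_ge0.
  by rewrite -mulr_suml -natr_sum nuE divff.
apply: le_trans (_ : \sum_(a : cfg) \sum_(nu | ok nu) product_weight (y nu) a <= _).
  apply: ler_sum => a _; rewrite (bigD1 (nua a)) /=; last first.
    rewrite /ok; apply/eqP; rewrite -[RHS](occupation_sum a).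
    by apply: eq_bigr => j _; rewrite nuaE.
  rewrite -[leLHS]addr0 lerD ?sumr_ge0 //.
    by rewrite le_eqVlt; apply/orP; left; apply/eqP; apply: eq_bigr => z _; rewrite /y nuaE.
  by move=> nu /andP[/sy s _]; exact: product_weight_ge0.
rewrite exchange_big /= (eq_bigr (fun=> 1)) => [|nu /sy s]; last first.
  exact: product_weight_sum.
rewrite sumr_const ler_nat (leq_trans (max_card _)) //.
by rewrite card_ffun !card_ord.
Qed.

Lemma Zn_gt0 : (0 < t)%N -> 0 < Zn t beta n.
Proof.
move=> t0; apply: lt_le_trans (Zn_lower t n_gt0 beta_gt0).
rewrite (bigD1 [ffun=> Ordinal t0]) //= ltr_wpDr ?expR_gt0 //.
by apply: sumr_ge0 => a _; exact: expR_ge0.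
Qed.

(** In the power of [n.+1], the exponent [t * t * t] comes from the highest weight bound and [t]
    from the number of empirical distributions. *)
Lemma ln_Zn_upper (M : R) : (0 < t)%N -> (forall x, simplex x -> phi t beta x <= M) ->
  ln (Zn t beta n) <= n%:R * M + beta / 2 + (t * t * t + t)%:R * ln n.+1%:R.
Proof.
move=> t0 leM.
have n1 : 0 < n.+1%:R :> R by rewrite ltr0n.
have ZE : Zn t beta n <= (n.+1 ^ (t * t * t + t))%:R * expR (n%:R * M + beta / 2).
  apply: le_trans (Zn_upper t beta n_gt0) _.
  rewrite expnD natrM -[leRHS]mulrA ler_wpM2l //.
  apply: le_trans (ler_sum _ (fun a _ => boltzmann_le a leM)) _.
  by rewrite -mulr_sumr mulrC ler_wpM2r ?expR_ge0 ?sum_empirical_weight.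
apply: le_trans (_ : _ <= ln ((n.+1 ^ (t * t * t + t))%:R * expR (n%:R * M + beta / 2))) _.
  by rewrite ler_ln ?posrE ?(lt_le_trans _ ZE) ?Zn_gt0.
rewrite lnM ?posrE ?expR_gt0 ?ltr0n ?expn_gt0 // expRK natrX lnXn // addrC.
by rewrite [_%:R * ln _]mulr_natl.
Qed.

End UpperBound.

(** * The variational problem and the limit *)

(** [ln u] is twice the logarithm of its square root. This serves both the continuity of [xlogx] at
    0 and the vanishing of [ln n / n]. *)
Lemma ln_le_2sqrt (R : realType) (u : R) : 0 < u -> ln u <= 2 * Num.sqrt u.
Proof.
move=> u0; have s0 : 0 < Num.sqrt u by rewrite sqrtr_gt0.
rewrite -[X in ln X](sqr_sqrtr (ltW u0)) lnXn // mulr2n mulr_natl mulr2n.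
by rewrite lerD // ltW // ln_sublinear.
Qed.

Lemma continuous_xlogx (R : realType) : continuous (@xlogx R).
Proof.
move=> u; rewrite (_ : @xlogx R = fun v => v * ln v); last first.
  by apply/funext=> v; rewrite xlogxE.
change (v * ln v @[v --> u] --> u * ln u).
have [u0|u0|->] := ltgtP u 0.
(* At negative arguments [ln] takes its default value 0. *)
- rewrite (ln0 (ltW u0)) mulr0; apply: cvg_near_cst; near=> v.
  by rewrite ln0 ?mulr0 // ltW //; near: v; exact: (lt_nbhsl u0).
- by apply: cvgM => //; exact: continuous_ln.
- rewrite mul0r.
  (* For small positive [v], the bound on [ln v^-1] gives [- (2 * Num.sqrt v) <= v * ln v <= 0]. *)
  have sqrt0 : (fun v : R => - (2 * Num.sqrt v)) @ (0 : R) --> (0 : R).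
    rewrite -[X in _ --> X]oppr0 -[X in _ --> - X](mulr0 2) -[X in 2 * X]sqrtr0.
    by apply: cvgN; apply: cvgMr; exact: sqrt_continuous.
  apply: (squeeze_cvgr _ sqrt0 (cvg_cst 0)); near=> v.
  have v1 : v <= 1 by apply: ltW; near: v; exact: (lt_nbhsl ltr01).
  have [v0|v0] := leP v 0; first by rewrite ln0 // mulr0 ler0_sqrtr // mulr0 oppr0 lexx.
  rewrite mulr_ge0_le0 ?ln_le0 ?(ltW v0) // andbT lerNl -mulrN -lnV ?posrE //.
  have vV0 : 0 < v^-1 by rewrite invr_gt0.
  apply: le_trans (_ : v * (2 * Num.sqrt v^-1) <= _).
    by rewrite ler_wpM2l ?ln_le_2sqrt // ltW.
  have s0 : 0 < Num.sqrt v by rewrite sqrtr_gt0.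
  rewrite (sqrtrV (ltW v0)) -[X in X * _](sqr_sqrtr (ltW v0)) mulrCA expr2 mulfK //.
  by rewrite gt_eqF.
Unshelve. all: by end_near. Qed.

Lemma continuous_sum_fin (R : realType) (T : topologicalType) (I : finType)
    (f : I -> T -> R) :
  (forall i, continuous (f i)) -> continuous (fun x => \sum_i f i x).
Proof. by move=> fc x; apply: cvg_sum_fin => i; exact: fc. Qed.

Section Maximiser.
Variables (R : realType) (t : nat) (beta : R).

(** The simplex is a cube cut by a closed hyperplane, hence compact, and [phi] is a sum of
    continuous functions of single coordinates up to a constant. *)
Lemma exists_simplex_max : (0 < t)%N -> exists2 x : 'I_t -> R, simplex x &
  forall y, simplex y -> phi t beta y <= phi t beta x.
Proof.
move=> t0.
pose A : set 'rV[R]_t := [set v : 'rV[R]_t | forall i, `[0, 1]%classic (v ord0 i)].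
pose B : set 'rV[R]_t := [set v : 'rV[R]_t | \sum_j v ord0 j = 1].
pose psi (u : R) := beta / 2 * u ^+ 2 - xlogx u.
have psic : continuous psi.
  move=> u; apply: cvgB; last exact: continuous_xlogx.
  by apply: cvgMr; exact: exprn_continuous.
have phiE x : phi t beta x = \sum_j psi (x j) - beta / 2.
  by rewrite /phi /psi sumrB -mulr_sumr mulrBr mulr1 addrAC.
pose f (v : 'rV[R]_t) := \sum_j psi (v ord0 j).
have coordc j : continuous (fun v : 'rV[R]_t => v ord0 j) by exact: coord_continuous.
have Bclosed : closed B.
  apply: (@closed_comp _ _ (fun v : 'rV[R]_t => \sum_j v ord0 j) [set 1]).
    by move=> v _; exact: continuous_sum_fin.
  exact: closed_eq.
have ABc : compact (A `&` B).
  apply: compact_closedI => //.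
  by apply: (@rV_compact R t (fun=> `[0, 1]%classic)) => i; exact: segment_compact.
have fc : continuous f.
  apply: continuous_sum_fin => j v.
  by apply: continuous_comp; [exact: coordc | exact: psic].
have simplexAB x : simplex x -> (A `&` B) (\row_j x j).
  move=> sx; split=> [i|] /=; first by rewrite mxE in_itv /= sx.1 simplex_le1.
  by rewrite /B /= -[RHS]sx.2; apply: eq_bigr => j _; rewrite mxE.
have fE x : f (\row_j x j) = \sum_j psi (x j).
  by apply: eq_bigr => j _; rewrite mxE.
have s0 : simplex (fun j : 'I_t => (j == Ordinal t0)%:R : R).
  split=> //; rewrite (bigD1 (Ordinal t0)) // big1 => [|j /negPf-> //].
  by rewrite eqxx /= addr0.
have AB0 : (A `&` B) !=set0 by eexists; exact: simplexAB s0.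
have [v + vmax] := compact_EVT_max AB0 ABc (continuous_subspaceT fc).
rewrite inE => -[Av Bv]; exists (fun j => v ord0 j).
  by split=> // j; have := Av j; rewrite /= in_itv => /andP[].
by move=> y /simplexAB yAB; rewrite !phiE lerD2r -fE; apply: vmax; rewrite inE.
Qed.

(** Sorting the coordinates of a maximiser in decreasing order changes neither [phi] nor membership
    in the simplex. *)
Lemma exists_Delta_max : (0 < t)%N -> exists2 x : 'I_t -> R, Delta t x &
  simplex x /\ forall y, simplex y -> phi t beta y <= phi t beta x.
Proof.
move=> t0; have [x sx xmax] := exists_simplex_max t0.
pose s := sort (fun u v : R => v <= u) (codom x).
have ss : size s = t by rewrite size_sort size_codom card_ord.
pose x' (j : 'I_t) := s`_j.
have sumE (F : R -> R) : \sum_j F (x' j) = \sum_j F (x j).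
  transitivity (\sum_(v <- s) F v); first by rewrite (big_nth 0) big_mkord ss.
  by rewrite (perm_big (codom x)) ?perm_sort // big_map big_enum.
have sx' : simplex x'.
  split=> [j|]; last by rewrite (sumE id) sx.2.
  have : x' j \in codom x by rewrite -(mem_sort (fun u v : R => v <= u)) mem_nth ?ss.
  by case/codomP=> i ->; exact: sx.1.
have phiE : phi t beta x' = phi t beta x.
  by rewrite /phi (sumE (fun u => u ^+ 2)) sumE.
exists x'; last by split=> // y /xmax; rewrite phiE.
split=> [j|]; first by rewrite sx'.1 simplex_le1.
split; last exact: sx'.2.
move=> i j ij; apply: (sorted_leq_nth (leT := fun u v : R => v <= u)).
- by move=> a b c /[swap]; exact: le_trans.
- by move=> a; exact: lexx.
- by apply: sort_sorted => a b; exact: le_total.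
- by rewrite inE ss.
- by rewrite inE ss.
- exact: ij.
Qed.

End Maximiser.

Lemma cvg_log_over_n (R : realType) (b c : R) :
  (fun n : nat => (b + c * ln n.+1%:R) / n%:R) @ \oo --> (0 : R).
Proof.
rewrite -(cvg_shiftS (fun n : nat => (b + c * ln n.+1%:R) / n%:R)) /=.
have h0 := @cvg_harmonic R.
(* The constant is 4 because [ln n.+2%:R <= 2 * Num.sqrt n.+2%:R] and [n.+2 <= 4 * n.+1]. *)
have s0 : (fun n : nat => 4 * Num.sqrt (harmonic n)) @ \oo --> (0 : R).
  rewrite -[X in _ --> X](mulr0 4) -[X in 4 * X]sqrtr0; apply: cvgMr.
  by apply: continuous_cvg => //; exact: sqrt_continuous.
have l0 : (fun n : nat => ln n.+2%:R / n.+1%:R : R) @ \oo --> (0 : R).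
  apply: (squeeze_cvgr _ (cvg_cst 0) s0); apply: nearW => n.
  have n1 : 0 < n.+1%:R :> R by rewrite ltr0n.
  rewrite divr_ge0 ?ln_ge0 ?ler1n //= ler_pdivrMr // sqrtrV ?ler0n //.
  have sq0 : 0 < Num.sqrt n.+1%:R :> R by rewrite sqrtr_gt0.
  rewrite -[X in _ * X](sqr_sqrtr (ltW n1)) expr2 mulrA divfK ?gt_eqF //.
  apply: le_trans (ln_le_2sqrt _) _; first by rewrite ltr0n.
  rewrite (_ : 4 = 2 * 2) -?natrM // natrM -mulrA ler_pM2l ?ltr0n //.
  rewrite -[leRHS]ger0_norm ?mulr_ge0 ?sqrtr_ge0 // -sqrtr_sqr ler_sqrt ?sqr_ge0 //.
  rewrite exprMn sqr_sqrtr ?ltW // -[n.+2%:R]natr1; have : 1 <= n.+1%:R :> R by rewrite ler1n.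
  lra.
rewrite (_ : (fun n : nat => _) =
    fun n : nat => b * harmonic n + c * (ln n.+2%:R / n.+1%:R)); last first.
  by apply/funext=> n; rewrite mulrDl mulrA.
suff : (fun n : nat => b * harmonic n + c * (ln n.+2%:R / n.+1%:R))
    @ \oo --> b * 0 + c * 0 by rewrite !mulr0 addr0.
by apply: cvgD; apply: cvgMr.
Qed.

(* S = twoS / 2, theta = 2S + 1 = twoS.+1 *)
Theorem theorem1p1 (R : realType) (twoS : nat) (beta : R) (hbeta : 0 < beta) :
  exists2 xmax : 'I_twoS.+1 -> R, Delta twoS.+1 xmax &
    (forall x, Delta twoS.+1 x -> phi twoS.+1 beta x <= phi twoS.+1 beta xmax) /\
    ((fun n : nat => ln (Zn twoS.+1 beta n) / n%:R) @ \oo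
       --> phi twoS.+1 beta xmax).
Proof.
have [x Dx [sx xmax]] := exists_Delta_max beta (ltn0Sn twoS).
exists x => //; split=> [y [y01 [_ y1]]|].
  by apply: xmax; split=> // j; case/andP: (y01 j).
set M := phi _ _ x; set t := twoS.+1 in x Dx sx xmax M *.
have lim : (fun n : nat => M + (beta / 2 + (t * t * t + t)%:R * ln n.+1%:R) / n%:R)
    @ \oo --> M.
  by rewrite -[X in _ --> X]addr0; apply: cvgD; [exact: cvg_cst | exact: cvg_log_over_n].
(* The lower bound is [M] itself; both bounds need [n > 0], which holds eventually. *)
apply: (squeeze_cvgr _ (cvg_cst M) lim); near=> n.
have n0 : (0 < n)%N by near: n; exact: nbhs_infty_gt.
rewrite ln_Zn_lower //= ler_pdivrMr ?ltr0n // mulrDl divfK ?pnatr_eq0 -?lt0n //.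
by rewrite mulrC addrA ln_Zn_upper.
Unshelve. all: by end_near. Qed.
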